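(* For every constant $K\ge1$ there is a constant $C$ such that for every $n$, the complete graph $G=K_n$ satisfies $\widetilde{\mathsf{EC}}(G)\le Cn^2$ for every choice of rotor sequence lengths with $\tilde\kappa\le K$.
   Context: Unweighted deterministic walk: each vertex $u$ has a rotor sequence of length $\tilde d(u)$ consisting of neighbours of $u$, each occurring exactly $\tilde d(u)/\deg(u)$ times, and an initial rotor position; $\tilde\kappa=\max_u\tilde d(u)/\deg(u)$. The walk moves from the current vertex to the vertex its rotor points at and then advances that rotor cyclically to the next entry. $\widetilde{\mathsf{EC}}(G)$ is the maximum over start vertices and all rotor sequences/initial positions (lengths fixed) of the first time at which every edge has been traversed. (The paper states its bounds for specific graphs under the standing assumption $\tilde\kappa=O(1)$.) *)

(* Defs.v *)
From mathcomp Require Import all_boot all_order all_algebra.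
From mathcomp Require Import classical_sets reals constructive_ereal ereal.

Set Implicit Arguments.
Unset Strict Implicit.
Unset Printing Implicit Defensive.

Import Order.TTheory GRing.Theory Num.Theory.

Local Open Scope nat_scope.

(* A simple graph is a symmetric irreflexive relation e on a finite type. *)

Definition deg (T : finType) (e : rel T) (u : T) : nat := #|[set v | e u v]|.

(* An isolated vertex has the empty rotor sequence; every other vertex has a
   nonempty one. *)
Definition rotor_lengths (T : finType) (e : rel T) (d : T -> nat) : bool :=
  [forall u, (deg e u %| d u) && ((0 < deg e u) ==> (0 < d u))].

(* The quotients are exact under rotor_lengths. *)
Definition kappa (T : finType) (e : rel T) (d : T -> nat) : nat :=
  \max_(u : T) (d u %/ deg e u).

Definition rotor_sequences (T : finType) (e : rel T) (d : T -> nat)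
    (s : forall u, (d u).-tuple T) : bool :=
  [forall u, all (e u) (s u) &&
     [forall v, e u v ==> (count_mem v (s u) == d u %/ deg e u)]].

(* A state is the current vertex together with all the rotor positions; ordS is
   the cyclic successor. *)
Definition rotor_step (T : finType) (d : T -> nat)
    (s : forall u, (d u).-tuple T) (c : T * (forall u, 'I_(d u))) :
    T * (forall u, 'I_(d u)) :=
  (tnth (s c.1) (c.2 c.1),
   fun u => if u == c.1 then ordS (c.2 u) else c.2 u).

Definition walk (T : finType) (d : T -> nat) (s : forall u, (d u).-tuple T)
    (p : forall u, 'I_(d u)) (x : T) (t : nat) : T :=
  (iter t (rotor_step s) (x, p)).1.

(* Edges are undirected: uv is traversed by a move from u to v or from v to u. *)
Definition edges_traversed (T : finType) (e : rel T) (d : T -> nat)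
    (s : forall u, (d u).-tuple T) (p : forall u, 'I_(d u)) (x : T) (t : nat) :
    bool :=
  [forall u, forall v, e u v ==>
     [exists i : 'I_t,
        ((walk s p x i == u) && (walk s p x i.+1 == v)) ||
        ((walk s p x i == v) && (walk s p x i.+1 == u))]].

(* The first time at which every edge has been traversed, +oo if there is no
   such time. *)
Definition edge_cover_time (R : realType) (T : finType) (e : rel T)
    (d : T -> nat) (s : forall u, (d u).-tuple T) (p : forall u, 'I_(d u))
    (x : T) : \bar R :=
  ereal_inf [set (t%:R)%:E | t in [set t : nat | edges_traversed e s p x t]]%classic.

Definition EC (R : realType) (T : finType) (e : rel T) (d : T -> nat) : \bar R :=
  \big[maxe/0%E]_(x : T)
    \big[maxe/0%E]_(s : {dffun forall u : T, (d u).-tuple T} |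
                    rotor_sequences e s)
      \big[maxe/0%E]_(p : {dffun forall u : T, 'I_(d u)})
        edge_cover_time R e s p x.

Definition complete_graph (n : nat) : rel 'I_n := [rel u v | u != v].

(* Main.v *)
Require Import Defs.
From mathcomp Require Import all_boot all_order all_algebra.
From mathcomp Require Import classical_sets reals constructive_ereal ereal.
From mathcomp Require Import zify.
Import Order.TTheory GRing.Theory Num.Theory.
Local Open Scope ring_scope.

(** Let N_u be the number of departures from u before time T.  A rotor of
    length k_u (n - 1) serves each of the n - 1 neighbours k_u times per turn, so
    the number of moves from u to v is at least (N_u - k_u (n - 1)) / (n - 1).
    Summing over u <> v bounds the arrivals at v from below, which gives
    T <= n N_v + (n - 1) + k (n - 1)^2 with k = max k_u.  For
    T = (2 k + 1) n^2 this forces N_v >= k (n - 1): the rotor of every vertex v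
    has made a full turn, hence v has used all its edges. *)

Section Walk.
Set Implicit Arguments.
Unset Strict Implicit.
Unset Printing Implicit Defensive.
Local Open Scope nat_scope.

Variables (T : finType) (d : T -> nat) (s : forall u, (d u).-tuple T).
Variables (p : forall u, 'I_(d u)) (x : T).

Let w := walk s p x.

Definition departures (u : T) (t : nat) : nat := \sum_(i < t) (w i == u).

Definition moves (u v : T) (t : nat) : nat :=
  \sum_(i < t) ((w i == u) && (w i.+1 == v)).

(** Reads the rotor of [u] alone, without the walk. The default [x] of [nth] is never returned:
    [p u] witnesses [0 < d u], so the index is in range. *)
Definition rotor_hits (u v : T) (m : nat) : nat :=
  \sum_(j < m) (nth x (s u) ((p u + j) %% d u) == v).

Lemma departuresS u t : departures u t.+1 = departures u t + (w t == u).
Proof. by rewrite /departures big_ord_recr. Qed.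

Lemma rotor_position u t :
  (iter t (rotor_step s) (x, p)).2 u = (p u + departures u t) %% d u :> nat.
Proof.
elim: t => [|t IH]; first by rewrite /departures big_ord0 addn0 /= modn_small.
rewrite departuresS iterS /w /walk.
case: (iter t _ _) IH => y q /= IH; rewrite [y == u]eq_sym.
case: (u == y) => /=; last by rewrite addn0 IH.
by rewrite IH -addn1 modnDml addnA.
Qed.

(** Successive departures from [u] use successive rotor entries, whatever happens in between, so
    time enters only through the number of departures. *)
Lemma moves_rotor_hits u v t : moves u v t = rotor_hits u v (departures u t).
Proof.
elim: t => [|t IH]; first by rewrite /moves /rotor_hits /departures !big_ord0.
rewrite /moves big_ord_recr -/(moves u v t) IH departuresS.
case: (eqVneq (w t) u) => [wt|_] /=; last by rewrite !addn0.
rewrite addn1 [RHS]/rotor_hits big_ord_recr; congr (_ + nat_of_bool (_ == _)).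
have -> : w t.+1 = tnth (s (w t)) ((iter t (rotor_step s) (x, p)).2 (w t)).
  by [].
by rewrite wt (tnth_nth x) rotor_position.
Qed.

(** A full turn started at [p u] reads a rotation of [s u], which is a permutation of it. *)
Lemma rotor_hits_turn u v : rotor_hits u v (d u) = count_mem v (s u).
Proof.
have -> : count_mem v (s u) = count_mem v (rot (p u) (s u)).
  by apply/permP; rewrite perm_sym perm_rot.
rewrite /rotor_hits -sum1_count (big_nth x) size_rot size_tuple big_mkord.
rewrite [RHS]big_mkcond; apply: eq_bigr => j _ /=.
have pd := ltn_ord (p u); have jd := ltn_ord j.
suff -> : nth x (rot (p u) (s u)) j = nth x (s u) ((p u + j) %% d u).
  by case: eqP.
rewrite /rot nth_cat size_drop size_tuple nth_drop.
case: ltnP => jp; first by rewrite modn_small //; lia.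
have -> : p u + j = (j - (d u - p u)) + d u by lia.
by rewrite modnDr modn_small ?nth_take //; lia.
Qed.

Lemma rotor_hitsD u v m :
  rotor_hits u v (d u + m) = rotor_hits u v (d u) + rotor_hits u v m.
Proof.
rewrite /rotor_hits big_split_ord; congr (_ + _); apply: eq_bigr => j _ /=.
by rewrite addnCA modnDl.
Qed.

Lemma rotor_hits_ge u v m : count_mem v (s u) * (m %/ d u) <= rotor_hits u v m.
Proof.
rewrite [X in _ <= rotor_hits u v X](divn_eq m (d u)).
elim: (m %/ d u) => [|q IH]; first by rewrite muln0.
by rewrite mulnS mulSn -addnA rotor_hitsD rotor_hits_turn leq_add2l.
Qed.

Lemma sum_departures t : \sum_u departures u t = t.
Proof.
rewrite /departures exchange_big -[RHS]card_ord -sum1_card; apply: eq_bigr => i _.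
rewrite (bigD1 (w i)) //= eqxx big1 // => u uw.
by rewrite eq_sym (negbTE uw).
Qed.

(** Arrivals at [v] are visits at times 1 to [t]. All but the one at time [t] are followed by a
    departure before time [t], hence the successor. *)
Lemma sum_moves_le v t : \sum_u moves u v t <= (departures v t).+1.
Proof.
apply: (@leq_trans (departures v t.+1)); last first.
  by rewrite departuresS -addn1 leq_add2l leq_b1.
rewrite /departures big_ord_recl /moves exchange_big.
apply: leq_trans (leq_addl _ _); apply: leq_sum => i _.
rewrite (bigD1 (w i)) //= eqxx big1 ?addn0 // => u uw.
by rewrite eq_sym (negbTE uw).
Qed.

Lemma moves_gt0P u v t :
  reflect (exists i : 'I_t, (w i == u) && (w i.+1 == v)) (0 < moves u v t).
Proof.
rewrite /moves lt0n sum_nat_eq0 negb_forall.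
apply: (iffP existsP) => -[i Hi]; exists i; first by case: (_ && _) Hi.
by rewrite Hi.
Qed.

End Walk.

Section Complete.
Set Implicit Arguments.
Unset Strict Implicit.
Unset Printing Implicit Defensive.
Local Open Scope nat_scope.

Variables (n : nat) (d : 'I_n -> nat).
Let G := @complete_graph n.
Hypothesis d_ok : rotor_lengths G d.
Let k := kappa G d.

Lemma deg_complete_graph u : deg G u = n.-1.
Proof.
rewrite /deg; have -> : [set v | G u v] = [set~ u].
  by apply/setP => v; rewrite !inE eq_sym.
by rewrite cardsC1 card_ord.
Qed.

Lemma rotor_lengthE u : d u = d u %/ n.-1 * n.-1.
Proof.
have /forallP/(_ u)/andP[] := d_ok.
by rewrite deg_complete_graph => /divnK ->.
Qed.

Lemma rotor_length_gt0 u : 1 < n -> 0 < d u.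
Proof.
move=> n1; have /forallP/(_ u)/andP[_] := d_ok.
by rewrite deg_complete_graph => /implyP; apply; lia.
Qed.

Lemma rotor_length_le u : d u <= k * n.-1.
Proof.
rewrite {1}rotor_lengthE leq_mul2r; apply/orP; right.
by rewrite -(deg_complete_graph u); apply: (leq_bigmax u).
Qed.

Variables (s : forall u, (d u).-tuple 'I_n) (p : forall u, 'I_(d u)) (x : 'I_n).
Hypothesis s_ok : rotor_sequences G s.

Lemma count_rotor u v : u != v -> count_mem v (s u) = d u %/ n.-1.
Proof.
move=> uv; have /forallP/(_ u)/andP[_] := s_ok.
by move=> /forallP/(_ v)/implyP/(_ uv)/eqP; rewrite deg_complete_graph.
Qed.

Let dep := departures s p x.
Let mov := moves s p x.

(** Each full turn costs [d u] departures and yields [d u %/ n.-1] moves to [v], a ratio of [n.-1].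
    The unfinished turn has fewer than [d u <= k * n.-1] departures. *)
Lemma departures_le_moves u v t :
  u != v -> dep u t <= mov u v t * n.-1 + k * n.-1.
Proof.
move=> uv; have := rotor_hits_ge s p x u v (dep u t).
rewrite -moves_rotor_hits -/mov count_rotor // => hits.
have du0 : 0 < d u by apply: leq_ltn_trans (ltn_ord (p u)).
rewrite {1}(divn_eq (dep u t) (d u)) leq_add //; last first.
  by rewrite (leq_trans _ (rotor_length_le u)) // ltnW ?ltn_pmod.
by rewrite {2}rotor_lengthE mulnA leq_mul2r [_ * (d u %/ _)]mulnC hits orbT.
Qed.

Lemma time_le_departures v t :
  t <= dep v t + ((dep v t).+1 * n.-1 + n.-1 * (k * n.-1)).
Proof.
rewrite -{1}(sum_departures s p x t) (bigD1 v) //= leq_add2l.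
have sum_le : \sum_(u | u != v) dep u t <=
    \sum_(u | u != v) (mov u v t * n.-1 + k * n.-1).
  by apply: leq_sum => u; apply: departures_le_moves.
apply: leq_trans sum_le _; rewrite big_split leq_add //=; last first.
  by rewrite sum_nat_const cardC1 card_ord.
rewrite -big_distrl leq_mul2r; apply/orP; right.
apply: leq_trans (sum_moves_le s p x v t).
by rewrite [leqRHS](bigD1 v) //= leq_addl.
Qed.

Lemma complete_graph_edges_traversed :
  edges_traversed G s p x ((k.*2).+1 * n ^ 2).
Proof.
set t := _ * n ^ 2; apply/forallP => u; apply/forallP => v; apply/implyP => uv.
have n1 : 1 < n.
  have : u != v :> nat by exact: uv.
  by have := ltn_ord u; have := ltn_ord v; lia.
(* The move is found in the direction from [u] to [v], by looking at the rotor of [u] only. *)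
suff /moves_gt0P[i Hi] : 0 < mov u v t by apply/existsP; exists i; rewrite Hi.
have full_turn : d u <= dep u t.
  (* Otherwise [dep u t < k * n.-1], and the time bound gives [t < k * n.-1 * (2 * n - 1)], which is
     below [2 * k * n ^ 2], contradicting the choice of [t]. *)
  rewrite leqNgt; apply/negP => few.
  have := time_le_departures u t; have := rotor_length_le u.
  move: few; rewrite /t -mul2n; case: (n) n1 => [//|m] _ /=; nia.
have du0 := rotor_length_gt0 u n1.
rewrite /mov moves_rotor_hits; apply: leq_trans (rotor_hits_ge _ _ _ _ _ _).
rewrite count_rotor // muln_gt0 [0 < dep _ _ %/ _]divn_gt0 // full_turn andbT.
by move: du0; rewrite {1}rotor_lengthE muln_gt0 => /andP[].
Qed.

End Complete.

Theorem theorem3p14 (R : realType) (K : R) (K_ge1 : 1 <= K) :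
  exists C : R, forall (n : nat) (d : 'I_n -> nat),
    rotor_lengths (@complete_graph n) d ->
    (kappa (@complete_graph n) d)%:R <= K ->
    (EC R (@complete_graph n) d <= (C * n%:R ^+ 2)%:E)%E.
Proof.
exists (2 * K + 1) => n d d_ok kK.
(* The maxima in [EC] start from 0, so the bound must be nonnegative. *)
have C_ge0 : (0 <= ((2 * K + 1) * n%:R ^+ 2)%:E)%E.
  by rewrite lee_fin mulr_ge0 ?exprn_ge0 // addr_ge0 ?mulr_ge0 // (le_trans _ K_ge1).
apply: bigmax_le => // x _; apply: bigmax_le => // s s_ok.
apply: bigmax_le => // p _.
have cover := complete_graph_edges_traversed d_ok p x s_ok.
(* Any time by which all edges are traversed bounds the infimum from above. *)
apply: le_trans (ereal_inf_lbound _) _; first by eexists; first exact: cover.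
rewrite lee_fin natrM natrX ler_wpM2r ?exprn_ge0 //.
by rewrite -natr1 -mul2n natrM lerD2r ler_wpM2l.
Qed.
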